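(* Let $Q\in\mathbb{R}^{n\times n}$ be symmetric positive definite with half-bandwidth at most $\nu$, where $0\le\nu\le n-1$, and let $r\in\mathbb{R}^n$. In exact arithmetic, the forward recursion for $F_0,\ldots,F_n$ given in the context computes the partition function: $$\sum_{v\in\mathcal{U}_\nu}F_n(v)=Z_r=\sum_{u\in\{0,1\}^n}\exp\{-W_r(u)\}.$$ A full-state implementation that propagates the weights along both outgoing branches of every state at each layer performs exactly $2n2^\nu$ branch updates. An implementation restricted to reachable states performs no more than this number. The arithmetic complexity is therefore $\mathcal{O}(n2^\nu)$, and retaining only two consecutive forward layers requires $\mathcal{O}(2^\nu)$ working memory. For fixed $\nu$, both bounds are linear in $n$. For an emitted noise-effect pattern $z^{(q)}$, its normalized full-space weight is $$p_r(z^{(q)})=\frac{\exp\{-W_r(z^{(q)})\}}{Z_r}.$$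
   Context: For $r\in\mathbb{R}^n$: $y_i=0$ if $r_i\ge0$ and $y_i=1$ otherwise; $s_i=1-2y_i$; $a=r-s$; and for $z\in\{0,1\}^n$, $$W_r(z)=\sum_{i=1}^n\alpha_iz_i+\sum_{1\le i<j\le n}\beta_{ij}z_iz_j,\qquad \alpha_i=2s_i(Qa)_i+2Q_{ii},\quad\beta_{ij}=4s_is_jQ_{ij}.$$ $Q$ has half-bandwidth at most $\nu$ if $Q_{ij}=0$ whenever $|i-j|>\nu$. The full-space weight is the probability mass function $p_r(z)=\exp\{-W_r(z)\}/Z_r$ on $\{0,1\}^n$, with $Z_r=\sum_{u\in\{0,1\}^n}\exp\{-W_r(u)\}$; $z^{(1)},\ldots,z^{(2^n)}$ is an ordering of $\{0,1\}^n$ by nondecreasing $W_r$ with a fixed deterministic tie-breaking rule. Trellis: the state space is $\mathcal{U}_\nu=\{0,1\}^\nu$ for $\nu\ge1$ and $\mathcal{U}_0=\{\varnothing\}$. For $\nu\ge1$, $u=(u_1,\ldots,u_\nu)\in\mathcal{U}_\nu$, $b\in\{0,1\}$, $1\le i\le n$, $$\gamma_i(u,b)=\alpha_ib+\sum_{d=1}^{\min\{\nu,i-1\}}\beta_{i-d,i}\,u_{\nu-d+1}\,b,$$ $T(u,b)=(b)$ if $\nu=1$, and $T(u,b)=(u_2,\ldots,u_\nu,b)$ if $\nu\ge2$; for $\nu=0$, $\gamma_i(\varnothing,b)=\alpha_ib$ and $T(\varnothing,b)=\varnothing$. The initial state is the all-zero tuple ($\varnothing$ if $\nu=0$). Forward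 recursion: $F_0(v)=1$ if $v$ is the initial state and $F_0(v)=0$ otherwise; for $i=1,\ldots,n$ and $v\in\mathcal{U}_\nu$, $$F_i(v)=\sum_{u\in\mathcal{U}_\nu}\ \sum_{b\in\{0,1\}:\,T(u,b)=v}F_{i-1}(u)\exp\{-\gamma_i(u,b)\}.$$ A branch update is the addition of one term $F_{i-1}(u)\exp\{-\gamma_i(u,b)\}$, for a triple $(i,u,b)$, to $F_i(T(u,b))$. *)

(* Defs.v *)
From HB Require Import structures.
From mathcomp Require Import all_boot all_order all_algebra.
From mathcomp Require Import reals sequences exp.

Set Implicit Arguments.
Unset Strict Implicit.
Unset Printing Implicit Defensive.

Import Order.TTheory GRing.Theory Num.Theory.
Local Open Scope ring_scope.

(* Indices of R^n are 0-based: i : 'I_n stands for the mathematical index i+1. *)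

Section Weights.
Context {R : realType} {n : nat}.
Implicit Types (Q : 'M[R]_n) (r : 'cV[R]_n) (z : n.-tuple bool) (i j : 'I_n).

Definition symmetric_posdef Q : Prop :=
  Q^T = Q /\ forall x : 'cV[R]_n, x != 0 -> 0 < (x^T *m Q *m x) 0 0.

Definition half_bandwidth_le Q (nu : nat) : Prop :=
  forall i j, (nu < `|i%:Z - j%:Z|)%N -> Q i j = 0.

Definition yvec r : 'cV[R]_n := \col_i (if 0 <= r i 0 then 0 else 1).

Definition svec r : 'cV[R]_n := \col_i (1 - 2 * yvec r i 0).

Definition avec r : 'cV[R]_n := r - svec r.

Definition alpha Q r i : R :=
  2 * svec r i 0 * (Q *m avec r) i 0 + 2 * Q i i.

Definition beta Q r i j : R := 4 * svec r i 0 * svec r j 0 * Q i j.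

Definition W Q r z : R :=
  \sum_i alpha Q r i * (tnth z i)%:R
  + \sum_(i : 'I_n) \sum_(j : 'I_n | (i < j)%N)
      beta Q r i j * (tnth z i)%:R * (tnth z j)%:R.

Definition partition_function Q r : R :=
  \sum_(z : n.-tuple bool) expR (- W Q r z).

Definition full_space_weight Q r z : R :=
  expR (- W Q r z) / partition_function Q r.

(* [tie] is the tie-breaking rule, a total order on {0,1}^n. *)
Definition ranked_before Q r (tie : rel (n.-tuple bool)) : rel (n.-tuple bool) :=
  fun z w => (W Q r z < W Q r w) || ((W Q r z == W Q r w) && tie z w).

Definition ranking Q r (tie : rel (n.-tuple bool)) : seq (n.-tuple bool) :=
  sort (ranked_before Q r tie) (enum {: n.-tuple bool}).

(* z^(q), for 1 <= q <= 2^n. *)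
Definition pattern Q r (tie : rel (n.-tuple bool)) (q : nat) : n.-tuple bool :=
  nth [tuple of nseq n false] (ranking Q r tie) q.-1.

End Weights.

Section Trellis.
Context {nu : nat}.
Implicit Types (u v : nu.-tuple bool).

Definition init_state : nu.-tuple bool := [tuple of nseq nu false].

(* Dropping the first entry of (u_1, ..., u_nu, b) gives (u_2, ..., u_nu, b) for
   nu >= 2, (b) for nu = 1 and the empty tuple for nu = 0. *)
Definition transition u (b : bool) : nu.-tuple bool :=
  [tuple of behead (rcons u b)].

(* States reachable from the initial state in exactly k transitions. *)
Fixpoint reachable (k : nat) : {set nu.-tuple bool} :=
  if k is k'.+1
  then [set transition ub.1 ub.2 | ub in setX (reachable k') [set: bool]]
  else [set init_state].

End Trellis.

Lemma ord_subn_proof n (i : 'I_n) (d : nat) : (i - d < n)%N.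
Proof. exact: leq_ltn_trans (leq_subr d i) (ltn_ord i). Qed.

Definition ord_subn n (i : 'I_n) (d : nat) : 'I_n := Ordinal (ord_subn_proof i d).

Section ForwardRecursion.
Context {R : realType} {n : nat}.
Variable nu : nat.
Implicit Types (Q : 'M[R]_n) (r : 'cV[R]_n) (i : 'I_n) (u v : nu.-tuple bool).

(* [i] is the 0-based index of the layer, hence the bound minn nu i;
   u_{nu-d+1} is the entry of u at 0-based position nu - d. *)
Definition gamma Q r i u (b : bool) : R :=
  alpha Q r i * b%:R
  + \sum_(1 <= d < (minn nu i).+1)
      beta Q r (ord_subn i d) i * (nth false u (nu - d))%:R * b%:R.

(* [forward Q r k] is F_k for 0 <= k <= n; the layer leading from F_k to F_{k+1}
   has 0-based index k. The value 0 is only taken for k > n. *)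
Fixpoint forward Q r (k : nat) (v : nu.-tuple bool) : R :=
  if k is k'.+1 then
    if insub k' is Some i then
      \sum_(u : nu.-tuple bool) \sum_(b : bool | transition u b == v)
        forward Q r k' u * expR (- gamma Q r i u b)
    else 0
  else (v == init_state)%:R.

End ForwardRecursion.

(* Implementations are straight-line programs over a store of real cells. The
   control flow of the forward recursion depends only on n and nu, so that a
   program has the type [seq (instr n nu)] and serves all Q and r; the
   coefficients alpha_i and beta_ij are its read-only input. *)
Section Programs.
Variables n nu : nat.
Notation state := (nu.-tuple bool).

(* inl (k, v): the entry v of the k-th layer buffer; inr k: the k-th register. *)
Definition cell : Type := ((nat * state) + nat)%type.

Definition buffer (k : nat) (v : state) : cell := inl (k, v).
Definition reg (k : nat) : cell := inr k.

Inductive instr : Type :=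
| Const of cell & bool                  (* c := 0 or c := 1 *)
| LoadAlpha of cell & 'I_n              (* c := alpha_i *)
| LoadBeta of cell & 'I_n & 'I_n        (* c := beta_ij *)
| Add of cell & cell & cell             (* c := c1 + c2 *)
| Mul of cell & cell & cell             (* c := c1 * c2 *)
| Opp of cell & cell                    (* c := - c1 *)
| Exp of cell & cell                    (* c := exp c1 *)
| Update of nat & 'I_n & state & bool & cell.
    (* the branch update (i, u, b), with F_i stored in the k-th buffer:
       buffer k (T(u,b)) := buffer k (T(u,b)) + c1 *)

Definition program := seq instr.

Definition cells_of (a : instr) : seq cell :=
  match a with
  | Const c _ => [:: c]
  | LoadAlpha c _ => [:: c]
  | LoadBeta c _ _ => [:: c]
  | Add c c1 c2 => [:: c; c1; c2]
  | Mul c c1 c2 => [:: c; c1; c2]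
  | Opp c c1 => [:: c; c1]
  | Exp c c1 => [:: c; c1]
  | Update k _ u b c1 => [:: buffer k (transition u b); c1]
  end.

(* Every instruction is charged one unit, data movements included. *)
Definition operations (P : program) : nat := size P.

Definition working_memory (P : program) : nat :=
  size (undup (flatten (map cells_of P))).

Definition updates (P : program) : seq ('I_n * state * bool) :=
  pmap (fun a => if a is Update _ i u b _ then Some (i, u, b) else None) P.

Definition branch_updates (P : program) : nat := size (updates P).

Section Semantics.
Context {R : realType}.
Variables (Q : 'M[R]_n) (r : 'cV[R]_n).

Definition store := cell -> R.

Definition write (st : store) (c : cell) (x : R) : store :=
  fun c' => if c' == c then x else st c'.

Definition exec (st : store) (a : instr) : store :=
  match a with
  | Const c b => write st c b%:R
  | LoadAlpha c i => write st c (alpha Q r i)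
  | LoadBeta c i j => write st c (beta Q r i j)
  | Add c c1 c2 => write st c (st c1 + st c2)
  | Mul c c1 c2 => write st c (st c1 * st c2)
  | Opp c c1 => write st c (- st c1)
  | Exp c c1 => write st c (expR (st c1))
  | Update k _ u b c1 =>
      let c := buffer k (transition u b) in write st c (st c + st c1)
  end.

Definition run (st : store) (P : program) : store := foldl exec st P.

(* Whenever the branch update (i, u, b) is executed, the term that is added is
   indeed F_{i-1}(u) exp(-gamma_i(u,b)). *)
Fixpoint updates_correct (st : store) (P : program) : Prop :=
  if P is a :: P' then
    (if a is Update _ i u b c1
     then st c1 = forward Q r i u * expR (- gamma Q r i u b) else True)
    /\ updates_correct (exec st a) P'
  else True.

(* P evaluates the forward recursion, whatever the initial contents of the
   store, by propagating exactly once along both outgoing branches of every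
   state in [active i] at the layer of 0-based index i; it leaves the sum of F_n
   in register 0. *)
Definition implements_forward (active : nat -> {set state}) (P : program) : Prop :=
  (forall (i : 'I_n) (u : state) (b : bool),
     count_mem (i, u, b) (updates P) = (u \in active i))
  /\ forall st : store,
       updates_correct st P /\ run st P (reg 0) = \sum_(v : state) forward Q r n v.

Definition full_state_implementation : program -> Prop :=
  implements_forward (fun=> [set: state]).

(* The layer of 0-based index i starts after i transitions. *)
Definition reachable_state_implementation : program -> Prop :=
  implements_forward (fun i => reachable i).

End Semantics.

Section TwoLayerProgram.
Variable active : nat -> {set state}.

(* F_k is kept in the buffer k mod 2. Register 0 is the output, register 1 is
   scratch, and register m + 2 holds the partial branch metric with m state bits
   still to be chosen. *)
Let out := reg 0.
Let tmp := reg 1.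
Let partial_metric (m : nat) := reg m.+2.

(* One branch update; gamma_i(u,b) is expected in cell c. *)
Definition branch_code (i : 'I_n) (u : state) (b : bool) (c : cell) : program :=
  [:: Opp tmp c; Exp tmp tmp; Mul tmp (buffer (i %% 2) u) tmp;
      Update (i.+1 %% 2) i u b tmp].

(* gamma_i(u,0) = 0, and gamma_i(u,1) is expected in cell c. *)
Definition state_code (i : 'I_n) (u : state) (c : cell) : program :=
  if u \in active i then
    Const tmp false :: branch_code i u false tmp ++ branch_code i u true c
  else [::].

(* Depth-first traversal of the states u extending the prefix w = (u_1, ...,
   u_{nu-m}). Cell c holds alpha_i plus the terms of gamma_i(u,1) contributed by
   w; the next bit is u_{nu-d+1} with d = m, and it contributes beta_{i-m,i} if
   it is 1 and m is at most the number i of preceding indices. *)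
Fixpoint traverse (i : 'I_n) (m : nat) (w : seq bool) (c : cell) : program :=
  if m is m'.+1 then
    traverse i m' (rcons w false) c ++
    (if (m <= i)%N then
       [:: LoadBeta tmp (ord_subn i m) i; Add (partial_metric m') c tmp] ++
       traverse i m' (rcons w true) (partial_metric m')
     else traverse i m' (rcons w true) c)
  else state_code i (insubd init_state w) c.

Definition layer_code (i : 'I_n) : program :=
  [seq Const (buffer (i.+1 %% 2) v) false | v <- enum {: state}] ++
  LoadAlpha (partial_metric nu) i :: traverse i nu [::] (partial_metric nu).

Definition two_layer_program : program :=
  [seq Const (buffer 0 v) (v == init_state) | v <- enum {: state}] ++
  flatten [seq layer_code i | i <- enum 'I_n] ++
  Const out false ::
  [seq Add out out (buffer (n %% 2) v) | v <- enum {: state}].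

End TwoLayerProgram.

Definition full_state_program : program := two_layer_program (fun=> [set: state]).

Definition reachable_state_program : program :=
  two_layer_program (fun i => reachable i).

End Programs.

(* Main.v *)
Require Import Defs.
From mathcomp Require Import all_boot all_order all_algebra.
From mathcomp Require Import reals sequences exp.
From mathcomp Require Import zify.
Import Order.TTheory GRing.Theory Num.Theory.
Local Open Scope ring_scope.

(** A state of the trellis consists of the last nu bits that were read, so under
    the bandwidth hypothesis the branch metrics along the path of z add up to
    W_r(z): the term beta_{ij} z_i z_j is charged at layer j if j - i <= nu, and
    vanishes otherwise. Summing F_n over the states thus sums exp(-W_r) over all
    paths. In the program, the metrics of one layer are computed by a depth-first
    traversal of the binary tree of state prefixes, which has O(2^nu) nodes, each
    at a constant cost; computing every metric separately would cost a further
    factor nu. *)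

(** * The forward recursion sums over paths *)

Lemma big_tuple_rcons {V : nmodType} {T : finType} (k : nat)
    (F : seq T -> V) :
  \sum_(t : k.+1.-tuple T) F t = \sum_(t : k.-tuple T) \sum_(x : T) F (rcons t x).
Proof.
pose h (p : k.-tuple T * T) : k.+1.-tuple T := [tuple of rcons p.1 p.2].
have h_inj : injective h.
  by move=> [t x] [t' x'] /(congr1 val)/= /rcons_inj [/val_inj -> ->].
have h_bij : bijective h.
  by apply: inj_card_bij => //; rewrite card_prod !card_tuple expnSr.
by rewrite (reindex h) /= ?pair_big //; exact: onW_bij.
Qed.

Section PartitionFunction.
Context {R : realType} {n nu : nat}.
Variables (Q : 'M[R]_n) (r : 'cV[R]_n).

Definition state_after (s : seq bool) : nu.-tuple bool :=
  foldl transition init_state s.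

(* The value 0 is only taken for k >= n. *)
Definition layer_metric (k : nat) (u : nu.-tuple bool) (b : bool) : R :=
  if insub k is Some i then gamma Q r i u b else 0.

(** Taken over plain sequences, so that the induction on layers can append one bit to a path of any
    length. *)
Definition path_metric (s : seq bool) : R :=
  \sum_(k < size s) layer_metric k (state_after (take k s)) (nth false s k).

Lemma layer_metric_ord (i : 'I_n) u b : layer_metric i u b = gamma Q r i u b.
Proof. by rewrite /layer_metric valK. Qed.

Lemma path_metric_rcons s b :
  path_metric (rcons s b)
  = path_metric s + layer_metric (size s) (state_after s) b.
Proof.
rewrite /path_metric size_rcons big_ord_recr /= -cats1 take_size_cat //.
rewrite nth_cat ltnn subnn /=; congr (_ + _); apply: eq_bigr => k _.
by rewrite takel_cat 1?ltnW // nth_cat ltn_ord.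
Qed.

Lemma forwardS (i : 'I_n) (v : nu.-tuple bool) :
  forward Q r i.+1 v = \sum_(u : nu.-tuple bool)
     \sum_(b : bool | transition u b == v)
        forward Q r i u * expR (- gamma Q r i u b).
Proof. by rewrite /= valK. Qed.

(* The test function f makes the induction on k go through. *)
Lemma sum_forward_mul (k : nat) (f : nu.-tuple bool -> R) : (k <= n)%N ->
  \sum_v forward Q r k v * f v
  = \sum_(t : k.-tuple bool) expR (- path_metric t) * f (state_after t).
Proof.
elim: k f => [|k IHk] f le_kn.
  rewrite (bigD1 init_state) //= eqxx mul1r big1 ?addr0; last first.
    by move=> v /negbTE ->; rewrite mul0r.
  rewrite (big_pred1 [tuple]) /=; last by move=> t; apply/esym/eqP/tuple0.
  by rewrite /path_metric big_ord0 oppr0 expR0 mul1r.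
pose i := Ordinal le_kn.
rewrite (big_tuple_rcons k
  (fun s => expR (- path_metric s) * f (state_after s))).
(* Each pair (u, b) feeds the single state [transition u b], so exchanging the sums evaluates f
   there. *)
transitivity (\sum_u forward Q r k u *
   \sum_b expR (- gamma Q r i u b) * f (transition u b)).
  transitivity (\sum_v \sum_u \sum_(b | transition u b == v)
    forward Q r k u * (expR (- gamma Q r i u b) * f (transition u b))).
    apply: eq_bigr => v _; rewrite (forwardS i) mulr_suml; apply: eq_bigr => u _.
    by rewrite mulr_suml; apply: eq_bigr => b /eqP ->; rewrite mulrA.
  rewrite exchange_big; apply: eq_bigr => u _; rewrite mulr_sumr.
  rewrite (exchange_big_dep xpredT) //=; apply: eq_bigr => b _.
  by rewrite (big_pred1 (transition u b)).
(* The inner sum over b, as a function of u, serves as the test function at layer k. *)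
rewrite IHk 1?ltnW //; apply: eq_bigr => t _; rewrite mulr_sumr.
apply: eq_bigr => b _; rewrite path_metric_rcons size_tuple.
rewrite (layer_metric_ord i) mulrA -expRD -opprD; congr (_ * f _).
by rewrite /state_after foldl_rcons.
Qed.

(** The state is a shift register: each bit enters on the right and pushes one out on the left.
    Prepending the initial zeros to s avoids a separate case for fewer than nu bits read. *)
Lemma state_afterE s :
  state_after s = drop (size s) (nseq nu false ++ s) :> seq bool.
Proof.
elim/last_ind: s => [|s b IHs]; first by rewrite cats0 drop0.
rewrite /state_after -cats1 foldl_cat /= -/(state_after s) IHs -drop1.
set t := nseq nu false ++ s; have le_st : (size s <= size t)%N.
  by rewrite size_cat leq_addl.
have -> : rcons (drop (size s) t) b = drop (size s) (rcons t b).
  rewrite -!cats1 drop_cat; case: ltnP => // le_ts.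
  have /eqP -> : (size s - size t == 0)%N by rewrite subn_eq0.
  by rewrite drop_oversize.
by rewrite drop_drop add1n size_cat addn1 -cats1 catA.
Qed.

(** The bound on d by [size s] keeps the position past the zero padding, so a bit of s itself is
    read. *)
Lemma nth_state_after s d : (0 < d <= minn nu (size s))%N ->
  nth false (state_after s) (nu - d) = nth false s (size s - d).
Proof.
rewrite leq_min => /and3P[d_gt0 le_d_nu le_d_s].
rewrite state_afterE nth_drop nth_cat size_nseq addnBA //.
have -> : (size s + nu - d = nu + (size s - d))%N by rewrite addnBA // addnC.
by rewrite ltnNge leq_addr /= addKn.
Qed.

(** The branch metric charges every pair whose larger index is j: with i = j - d, distances d up to
    nu occur in [gamma], and larger ones have beta equal to 0. *)
Lemma gamma_state_after (z : n.-tuple bool) (j : 'I_n) :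
  half_bandwidth_le Q nu ->
  gamma Q r j (state_after (take j z)) (tnth z j)
  = alpha Q r j * (tnth z j)%:R
    + \sum_(i : 'I_n | (i < j)%N)
        beta Q r i j * (tnth z i)%:R * (tnth z j)%:R.
Proof.
move=> Qband; have szj : size (take j z) = j.
  by rewrite size_takel // size_tuple ltnW.
pose H d : R := beta Q r (ord_subn j d) j * (nth false z (j - d))%:R
  * (tnth z j)%:R.
congr (_ + _); transitivity (\sum_(1 <= d < (minn nu j).+1) H d).
  apply: eq_big_nat => d; rewrite ltnS => d_bound.
  rewrite nth_state_after ?szj // nth_take //.
  by case/andP: d_bound; rewrite leq_min => ? /andP[_ ?]; rewrite ltn_subrL; lia.
(* The range grows only if nu < j, and then each new d exceeds nu and falls outside the band. *)
transitivity (\sum_(1 <= d < j.+1) H d).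
  rewrite (@big_cat_nat _ _ _ (minn nu j).+1 1 j.+1) ?ltnS ?geq_minr //=.
  rewrite [X in _ = _ + X]big_nat_cond [X in _ = _ + X]big1 ?addr0 // => d.
  rewrite andbT => ?; rewrite /H /beta Qband ?mulr0 ?mul0r //=; lia.
(* Reversing the order of summation turns the distance d into the index i = j - d. *)
rewrite big_add1 /= big_nat_rev /= add0n big_mkord.
rewrite (big_ord_widen n (fun i => H (j - i.+1).+1)) 1?ltnW //.
apply: eq_bigr => i lt_ij; rewrite /H subnSK // subKn 1?ltnW //.
rewrite -tnth_nth; congr (beta Q r _ _ * _ * _).
by apply: val_inj; rewrite /= subKn 1?ltnW.
Qed.

Lemma path_metricE (z : n.-tuple bool) :
  half_bandwidth_le Q nu -> path_metric z = W Q r z.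
Proof.
move=> Qband; rewrite /path_metric size_tuple /W.
(* The pairs of W are regrouped by their larger index, the layer at which they are charged. *)
rewrite [X in _ = _ + X](exchange_big_dep xpredT) //= -big_split /=.
apply: eq_bigr => j _.
by rewrite layer_metric_ord -gamma_state_after // (tnth_nth false).
Qed.

Lemma sum_forward : half_bandwidth_le Q nu ->
  \sum_(v : nu.-tuple bool) forward Q r n v = partition_function Q r.
Proof.
move=> Qband; transitivity (\sum_v forward Q r n v * (fun=> 1) (v : nu.-tuple bool)).
  by apply: eq_bigr => v _; rewrite mulr1.
rewrite (sum_forward_mul _ (fun=> 1)) //; apply: eq_bigr => z _.
by rewrite path_metricE // mulr1.
Qed.

End PartitionFunction.

(** * Branch updates *)

Lemma prefix_rcons_nth {T : eqType} (x0 : T) (w u : seq T) (x : T) :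
  (size w < size u)%N ->
  prefix (rcons w x) u = prefix w u && (nth x0 u (size w) == x).
Proof.
move=> lt_wu; rewrite !prefixE size_rcons (take_nth x0) //.
exact: eqseq_rcons.
Qed.

Lemma state_of_seq {nu : nat} (w : seq bool) :
  size w = nu -> w = (insubd init_state w : nu.-tuple bool).
Proof. by move=> szw; apply/esym/(insubdK init_state)/eqP. Qed.

Section Updates.
Context {n nu : nat}.
Implicit Types (P : program n nu) (active : nat -> {set nu.-tuple bool}).

Lemma updates_cat P1 P2 : updates (P1 ++ P2) = updates P1 ++ updates P2.
Proof. exact: pmap_cat. Qed.

Lemma traverseS active (i : 'I_n) m w c :
  traverse active i m.+1 w c =
    traverse active i m (rcons w false) c ++
    (if (m.+1 <= i)%N then
       [:: LoadBeta (reg nu 1) (ord_subn i m.+1) i;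
           Add n (reg nu m.+2) c (reg nu 1)] ++
       traverse active i m (rcons w true) (reg nu m.+2)
     else traverse active i m (rcons w true) c).
Proof. by []. Qed.

Lemma updates_Const (f : nu.-tuple bool -> bool) k s :
  updates [seq Const n (buffer k v) (f v) | v <- s] = [::].
Proof. by elim: s. Qed.

(** The next bit splits the extensions of w into two disjoint families, one per recursive call, so
    each leaf is visited once. *)
Lemma count_updates_traverse active (i j : 'I_n) u b m w c :
  (size w + m)%N = nu ->
  count_mem (j, u, b) (updates (traverse active i m w c))
  = [&& j == i, u \in active i & prefix w u] :> nat.
Proof.
elim: m w c => [|m IHm] w c szw.
  have /state_of_seq eq_w : size w = nu by rewrite -szw addn0.
  rewrite /= {2}eq_w; set u0 := insubd _ _.
  have -> : prefix u0 u = (u == u0).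
    by rewrite prefixE size_tuple take_oversize ?size_tuple.
  rewrite /state_code; case: ifP => u0_act /=; last first.
    by case: (eqVneq u u0) => [->|]; rewrite ?u0_act ?andbF.
  rewrite !xpair_eqE [i == j]eq_sym [u0 == u]eq_sym.
  case: (j == i) => //=; case: (eqVneq u u0) => [->|]; rewrite ?andbF //= u0_act.
  by case: b.
have szwb x : (size (rcons w x) + m)%N = nu by rewrite size_rcons addSnnS.
rewrite traverseS updates_cat count_cat IHm //.
(* Both alternatives perform the same updates; they differ only in where the metric is kept. *)
have -> : count_mem (j, u, b) (updates (if (m.+1 <= i)%N then
       [:: LoadBeta (reg nu 1) (ord_subn i m.+1) i;
           Add n (reg nu m.+2) c (reg nu 1)] ++
       traverse active i m (rcons w true) (reg nu m.+2)
     else traverse active i m (rcons w true) c))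
  = [&& j == i, u \in active i & prefix (rcons w true) u].
  by case: ifP => _; rewrite ?updates_cat /= IHm.
rewrite !(prefix_rcons_nth false) ?size_tuple -?szw ?addnS ?ltnS ?leq_addr //.
case: (j == i) => //; case: (u \in _) => //=; case: (prefix _ _) => //=.
by case: (nth _ _ _).
Qed.

Lemma count_updates_layer active (i j : 'I_n) u b :
  count_mem (j, u, b) (updates (layer_code active i))
  = (j == i) && (u \in active i) :> nat.
Proof.
rewrite updates_cat count_cat (updates_Const (fun=> false)) /=.
by rewrite count_updates_traverse //= prefix0s andbT.
Qed.

Lemma count_updates_two_layer active (i : 'I_n) u b :
  count_mem (i, u, b) (updates (two_layer_program n active))
  = (u \in active i).
Proof.
rewrite /two_layer_program !updates_cat !count_cat updates_Const /=.
have -> s : updates [seq Add n (reg nu 0) (reg nu 0) (buffer (n %% 2) v)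
    | v : nu.-tuple bool <- s] = [::] by elim: s.
rewrite addn0 add0n.
have : uniq (enum 'I_n) by exact: enum_uniq.
have : i \in enum 'I_n by rewrite mem_enum.
elim: (enum 'I_n) => //= j s IHs; rewrite inE updates_cat count_cat.
rewrite count_updates_layer => i_js /andP[j_s s_uniq].
have nin (k : 'I_n) (s' : seq 'I_n) : k \notin s' -> count_mem (k, u, b)
    (updates (flatten [seq layer_code active l | l <- s'])) = 0%N.
  elim: s' => //= l s' IHs'; rewrite inE negb_or => /andP[kl /IHs' ks'].
  by rewrite updates_cat count_cat ks' count_updates_layer (negbTE kl).
case: (eqVneq i j) i_js => [ij _ | _ /= i_s]; last by rewrite IHs.
by rewrite ij nin // addn0.
Qed.

(** Reduces the total count to the multiplicities of single branches, which are what
    [implements_forward] prescribes. *)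
Lemma branch_updatesE P :
  branch_updates P = (\sum_(x : 'I_n * nu.-tuple bool * bool)
    count_mem x (updates P))%N.
Proof.
rewrite /branch_updates; elim: (updates P) => [|x s IHs] /=.
  by rewrite big1.
rewrite big_split /= -IHs (bigD1 x) //= eqxx big1 ?add1n // => y.
by rewrite eq_sym => /negbTE ->.
Qed.

End Updates.

Lemma full_branch_updates (R : realType) n nu (Q : 'M[R]_n) r
    (P : program n nu) :
  full_state_implementation Q r P -> branch_updates P = (2 * n * 2 ^ nu)%N.
Proof.
case=> cnt _; rewrite branch_updatesE.
rewrite (eq_bigr (fun=> 1%N)); last by move=> [[i u] b] _; rewrite cnt inE.
by rewrite sum1_card !card_prod card_ord card_tuple card_bool mulnC mulnA.
Qed.

Lemma reachable_branch_updates (R : realType) n nu (Q : 'M[R]_n) r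
    (P : program n nu) :
  reachable_state_implementation Q r P ->
  (branch_updates P <= 2 * n * 2 ^ nu)%N.
Proof.
case=> cnt _; rewrite branch_updatesE.
have -> : (2 * n * 2 ^ nu)%N = #|{: 'I_n * nu.-tuple bool * bool}|.
  by rewrite !card_prod card_ord card_tuple card_bool -mulnA mulnC.
rewrite -sum1_card; apply: leq_sum => -[[i u] b] _.
by rewrite cnt leq_b1.
Qed.

(** * Correctness of the two-layer program *)

Lemma cell_eqE {nu : nat} :
  (forall k (v : nu.-tuple bool) l, (buffer k v == reg nu l) = false)
  * (forall k l (v : nu.-tuple bool), (reg nu l == buffer k v) = false)
  * (forall k l (u v : nu.-tuple bool),
       (buffer k u == buffer l v) = (k == l) && (u == v))
  * (forall k l, (reg nu k == reg nu l) = (k == l)).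
Proof. by []. Qed.

(** Consecutive layers occupy different buffers, so that writing one leaves the other intact. *)
Lemma eqn_mod2S i : (i %% 2 == i.+1 %% 2)%N = false.
Proof. lia. Qed.

Section Semantics.
Context {R : realType} {n nu : nat}.
Variables (Q : 'M[R]_n) (r : 'cV[R]_n).
Variable active : nat -> {set nu.-tuple bool}.
Implicit Types (P : program n nu) (st : @store nu R) (u v : nu.-tuple bool).

Lemma run_cat st P1 P2 : run Q r st (P1 ++ P2) = run Q r (run Q r st P1) P2.
Proof. exact: foldl_cat. Qed.

Lemma updates_correct_cat st P1 P2 : updates_correct Q r st P1 ->
  updates_correct Q r (run Q r st P1) P2 ->
  updates_correct Q r st (P1 ++ P2).
Proof. by elim: P1 st => //= a P1 IHP st [? ?] ?; split=> //; apply: IHP. Qed.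

Definition branch_term (i : 'I_n) u b : R :=
  forward Q r i u * expR (- gamma Q r i u b).

Lemma branch_code_spec (i : 'I_n) u b c st :
  let P := branch_code i u b c in
  st c = gamma Q r i u b -> st (buffer (i %% 2) u) = forward Q r i u ->
  updates_correct Q r st P /\
  forall x, run Q r st P x =
    if x == buffer (i.+1 %% 2) (transition u b) then st x + branch_term i u b
    else if x == reg nu 1 then branch_term i u b else st x.
Proof.
rewrite /branch_code /= => st_c st_u.
rewrite /write /= st_c st_u; split=> // x.
by have [->|_] // := eqVneq x (buffer _ _); case: (x == reg nu 1).
Qed.

(* An upper bound on the cells that traversing, at layer i, the extensions of a
   prefix with m bits still to be chosen may modify. *)
Definition written (i m : nat) (x : cell nu) : bool :=
  match x with
  | inl (k, _) => k == i.+1 %% 2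
  | inr k => k < m.+2
  end%N.

Lemma gamma0 (i : 'I_n) u : gamma Q r i u false = 0.
Proof. by rewrite /gamma mulr0 add0r big1 // => d _; rewrite mulr0. Qed.

Lemma state_code_spec (i : 'I_n) u k st :
  let P := state_code active i u (reg nu k.+2) in
  st (buffer (i %% 2) u) = forward Q r i u ->
  st (reg nu k.+2) = gamma Q r i u true ->
  [/\ updates_correct Q r st P,
    forall v, run Q r st P (buffer (i.+1 %% 2) v)
      = st (buffer (i.+1 %% 2) v) +
        (if u \in active i then \sum_(b | transition u b == v) branch_term i u b
         else 0)
    & forall x, ~~ written i 0 x -> run Q r st P x = st x].
Proof.
move=> P st_u st_c; rewrite {}/P /state_code; case: ifP => u_act; last first.
  by split=> // v; rewrite addr0.
(* The zero in the scratch register is the metric of the branch with bit 0. *)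
set st0 := write st (reg nu 1) 0.
have st0E x : st0 x = if x == reg nu 1 then 0 else st x by [].
have [] := @branch_code_spec i u false (reg nu 1) st0.
- by rewrite st0E eqxx gamma0.
- by rewrite st0E cell_eqE.
set st1 := run _ _ _ _ => ok1 st1E.
have [] := @branch_code_spec i u true (reg nu k.+2) st1.
- by rewrite st1E st0E !cell_eqE.
- by rewrite st1E st0E !cell_eqE eqn_mod2S.
set st2 := run _ _ _ _ => ok2 st2E.
have -> : run Q r st (Const n (reg nu 1) false ::
    branch_code i u false (reg nu 1) ++ branch_code i u true (reg nu k.+2))
  = st2 by rewrite -cat1s !run_cat.
split.
- by split=> //; apply: updates_correct_cat.
- move=> v; rewrite st2E st1E st0E !cell_eqE !eqxx /= big_mkcond big_bool /=.
  (* The two tests are treated independently, since for nu = 0 both branches enter the same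
     state. *)
  rewrite ![v == _]eq_sym.
  by do 2!case: (_ == v); rewrite ?addr0 ?add0r // -addrA [X in _ + X]addrC.
- move=> [[l v]|l] /=.
    move=> /negbTE neq; rewrite st2E st1E st0E.
    by rewrite -/(buffer l v) !cell_eqE neq.
  rewrite -leqNgt => l_gt1; rewrite st2E st1E st0E -/(reg nu l) !cell_eqE.
  by rewrite gtn_eqF.
Qed.

(* The content of the metric cell during the traversal: the terms of gamma_i(u,1)
   determined by the prefix w of u, when m bits remain to be chosen. *)
Definition partial_gamma (i : 'I_n) (m : nat) (w : seq bool) : R :=
  alpha Q r i + \sum_(m.+1 <= d < (minn nu i).+1)
    beta Q r (ord_subn i d) i * (nth false w (nu - d))%:R.

Lemma partial_gamma0 (i : 'I_n) u :
  partial_gamma i 0 u = gamma Q r i u true.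
Proof.
rewrite /gamma mulr1; congr (_ + _).
by apply: eq_bigr => d _; rewrite mulr1.
Qed.

Lemma partial_gamma_nil (i : 'I_n) : partial_gamma i nu [::] = alpha Q r i.
Proof. by rewrite /partial_gamma big_geq ?addr0 // ltnS geq_minl. Qed.

(** The new bit has position [size w] = nu - (m + 1), so it supplies the term d = m + 1 and leaves
    those with larger d unchanged. If m + 1 > i, both sums are empty. *)
Lemma partial_gamma_rcons (i : 'I_n) m w b : (size w + m.+1)%N = nu ->
  partial_gamma i m (rcons w b) = partial_gamma i m.+1 w +
    (if (m.+1 <= i)%N then beta Q r (ord_subn i m.+1) i * b%:R else 0).
Proof.
move=> szw; rewrite /partial_gamma.
have tailE : \sum_(m.+2 <= d < (minn nu i).+1)
    beta Q r (ord_subn i d) i * (nth false (rcons w b) (nu - d))%:R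
  = \sum_(m.+2 <= d < (minn nu i).+1)
    beta Q r (ord_subn i d) i * (nth false w (nu - d))%:R.
  apply: eq_big_nat => d d_bound; rewrite nth_rcons ifT //; lia.
case: ifP => le_mi.
  rewrite big_ltn ?tailE; last lia.
  have -> : (nu - m.+1 = size w)%N by lia.
  by rewrite nth_rcons ltnn eqxx addrA addrAC.
by rewrite addr0 !big_geq //; lia.
Qed.

(** The register index k is independent of m because a bit that adds nothing to the metric inherits
    the cell of its ancestor. The condition m <= k keeps that cell outside the [written] ones. *)
Lemma traverse_spec (i : 'I_n) m w k st :
  let P := traverse active i m w (reg nu k.+2) in
  (size w + m)%N = nu -> (m <= k)%N ->
  (forall u, st (buffer (i %% 2) u) = forward Q r i u) ->
  st (reg nu k.+2) = partial_gamma i m w ->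
  [/\ updates_correct Q r st P,
    forall v, run Q r st P (buffer (i.+1 %% 2) v)
      = st (buffer (i.+1 %% 2) v) +
        \sum_(u in active i | prefix w u)
          \sum_(b | transition u b == v) branch_term i u b
    & forall x, ~~ written i m x -> run Q r st P x = st x].
Proof.
elim: m w k st => [|m IHm] w k st P szw le_mk st_buf st_k.
  have /state_of_seq eq_w : size w = nu by rewrite -szw addn0.
  rewrite {}/P /=; move: st_k eq_w; set u0 := insubd _ _.
  move=> + eq_w; rewrite eq_w partial_gamma0 => st_k.
  have [//|//|ok1 st1E frame1] := @state_code_spec i u0 k st.
  split=> // v; rewrite st1E; congr (_ + _).
  have prefE u : prefix u0 u = (u == u0).
    by rewrite prefixE size_tuple take_oversize ?size_tuple.
  under eq_bigl => u do rewrite prefE andbC.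
  by rewrite big_mkcondr big_pred1_eq.
have szwb x : (size (rcons w x) + m)%N = nu by rewrite size_rcons addSnnS.
have writtenW x : ~~ written i m.+1 x -> ~~ written i m x.
  by case: x => [[]|] //= l; rewrite -!leqNgt => /ltnW.
rewrite {}/P traverseS.
have [//| |//| |] := IHm (rcons w false) k st; first exact: ltnW.
  rewrite partial_gamma_rcons // st_k; case: ifP; rewrite ?mulr0 addr0 //.
set st1 := run _ _ _ _ => ok1 st1E frame1.
have st1_buf u : st1 (buffer (i %% 2) u) = forward Q r i u.
  by rewrite frame1 //= eqn_mod2S.
(* The metric of w survives the first subtree, hence is available for the second. *)
have st1_k : st1 (reg nu k.+2) = partial_gamma i m.+1 w.
  by rewrite frame1 //= -leqNgt 2!ltnS ltnW.
pose P2 := if (m.+1 <= i)%N then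
       [:: LoadBeta (reg nu 1) (ord_subn i m.+1) i;
           Add n (reg nu m.+2) (reg nu k.+2) (reg nu 1)] ++
       traverse active i m (rcons w true) (reg nu m.+2)
     else traverse active i m (rcons w true) (reg nu k.+2).
rewrite -/P2.
(* Whichever alternative is taken, [P2] must handle the extensions with next bit 1; the sum over
   extensions of w is then split on that bit. *)
suff [ok2 st2E frame2] : [/\ updates_correct Q r st1 P2,
    forall v, run Q r st1 P2 (buffer (i.+1 %% 2) v)
      = st1 (buffer (i.+1 %% 2) v) +
        \sum_(u in active i | prefix (rcons w true) u)
          \sum_(b | transition u b == v) branch_term i u b
    & forall x, ~~ written i m.+1 x -> run Q r st1 P2 x = st1 x].
  split.
  - exact: updates_correct_cat.
  - move=> v; rewrite run_cat st2E st1E -addrA; congr (_ + _).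
    rewrite [RHS](bigID (fun u => nth false (tval u) (size w))) /= addrC.
    congr (_ + _); apply: eq_bigl => u;
      rewrite (prefix_rcons_nth false) ?size_tuple -?szw ?addnS ?ltnS
        ?leq_addr // andbA;
      by case: (nth _ _ _); rewrite ?andbT ?andbF.
  - by move=> x xw; rewrite run_cat frame2 // frame1 // writtenW.
rewrite /P2; case: ifP => le_mi; last first.
  have [//| |//| |ok2 st2E frame2] := IHm (rcons w true) k st1.
  - exact: ltnW.
  - by rewrite partial_gamma_rcons // le_mi addr0.
  by split=> // x /writtenW; apply: frame2.
set P3 := [:: _; _].
have st3E x : run Q r st1 P3 x = if x == reg nu m.+2 then
    partial_gamma i m (rcons w true)
    else if x == reg nu 1 then beta Q r (ord_subn i m.+1) i else st1 x.
  rewrite /= /write /= st1_k partial_gamma_rcons // le_mi.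
  by rewrite mulr1.
(* The enlarged metric sits in register m + 2, the first one that the subtree does not write, whence
   k = m. *)
have [//|//| | |ok2 st2E frame2] := IHm (rcons w true) m (run Q r st1 P3).
- by move=> u; rewrite st3E !cell_eqE.
- by rewrite st3E eqxx.
split.
- exact: updates_correct_cat.
- by move=> v; rewrite run_cat st2E st3E !cell_eqE.
- move=> x xw; rewrite run_cat frame2 ?writtenW // st3E.
  case: x xw => [[l v]|l] //=; rewrite -/(reg nu l) !cell_eqE -leqNgt => lt_ml.
  by rewrite !gtn_eqF // (leq_trans _ lt_ml).
Qed.

Lemma run_Const k (f : nu.-tuple bool -> bool) s st :
  let P := [seq Const n (buffer k v) (f v) | v <- s] in
  updates_correct Q r st P /\
  forall x, run Q r st P x =
    if x is inl (l, v) then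
      if (l == k) && (v \in s) then (f v)%:R else st x
    else st x.
Proof.
elim: s st => [|u s IHs] st /=.
  by split=> // -[[l v]|l] //; rewrite andbF.
have [ok runE] := IHs (write st (buffer k u) (f u)%:R).
split=> // x; rewrite runE; case: x => [[l v]|l] //; rewrite inE /write.
rewrite -/(buffer l v) cell_eqE; case: (l == k) => //=.
by case: eqVneq => [->|_] //=; case: ifP.
Qed.

(** Skipping a state is harmless when its forward weight is zero; this treats full and reachable
    traversals at once. *)
Hypothesis forward_inactive : forall (i : 'I_n) (u : nu.-tuple bool),
  u \notin active i -> forward Q r i u = 0.

Lemma layer_code_spec (i : 'I_n) st :
  (forall u, st (buffer (i %% 2) u) = forward Q r i u) ->
  updates_correct Q r st (layer_code active i) /\
  forall v, run Q r st (layer_code active i) (buffer (i.+1 %% 2) v)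
    = forward Q r i.+1 v.
Proof.
move=> st_buf; rewrite /layer_code.
set P1 := map _ _; have [ok1 run1] := run_Const (i.+1 %% 2) (fun=> false)
  (enum {: nu.-tuple bool}) st.
rewrite -cat1s; set P2 := [:: _]; set st2 := run Q r (run Q r st P1) P2.
have [//|//| | |ok3 run3 _] := traverse_spec i nu [::] nu st2.
- move=> u; rewrite /st2 /= /write cell_eqE run1 /=.
  by rewrite eqn_mod2S /=; exact: st_buf.
- by rewrite partial_gamma_nil /st2 /= /write eqxx.
split.
  apply: updates_correct_cat => //; exact: updates_correct_cat.
move=> v; rewrite 2!run_cat -/st2 run3 forwardS.
rewrite {1}/st2 /= /write cell_eqE run1 /= eqxx mem_enum add0r.
rewrite [RHS](bigID [in active i]) /= [X in _ = _ + X]big1 ?addr0.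
  by apply: eq_bigl => u; rewrite prefix0s andbT.
move=> u u_inact; rewrite big1 // => b _.
by rewrite forward_inactive // mul0r.
Qed.

(** Stated for any block of consecutive layers, so that the induction can remove the first one. *)
Lemma layers_spec a (s : seq 'I_n) st : map val s = iota a (size s) ->
  let P := flatten [seq layer_code active i | i <- s] in
  (forall u, st (buffer (a %% 2) u) = forward Q r a u) ->
  updates_correct Q r st P /\
  forall v, run Q r st P (buffer ((a + size s) %% 2) v)
    = forward Q r (a + size s) v.
Proof.
elim: s a st => [|i s IHs] a st /=; first by rewrite addn0.
move=> [<- s_iota] st_buf; have [ok1 run1] := layer_code_spec i st st_buf.
have [ok2 run2] := IHs i.+1 _ s_iota run1.
split; first exact: updates_correct_cat.
by move=> v; rewrite run_cat -addSnnS run2.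
Qed.

Lemma two_layer_program_spec st :
  updates_correct Q r st (two_layer_program n active) /\
  run Q r st (two_layer_program n active) (reg nu 0)
  = \sum_(v : nu.-tuple bool) forward Q r n v.
Proof.
rewrite /two_layer_program; set P1 := map _ _.
have [ok1 run1] := run_Const 0 (fun v : nu.-tuple bool => v == init_state)
  (enum {: nu.-tuple bool}) st.
have [| |ok2] := layers_spec 0 (enum 'I_n) (run Q r st P1).
- by rewrite val_enum_ord size_enum_ord.
- by move=> u; rewrite run1 /= mem_enum.
rewrite size_enum_ord add0n; set P2 := flatten _ => run2.
rewrite -cat1s; set st2 := run Q r (run Q r st P1) P2.
have addE (s : seq (nu.-tuple bool)) (st' : store nu) : run Q r st'
    [seq Add n (reg nu 0) (reg nu 0) (buffer (n %% 2) v) | v <- s] (reg nu 0)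
  = st' (reg nu 0) + \sum_(v <- s) st' (buffer (n %% 2) v).
  elim: s st' => [|v s IHs] st' /=; first by rewrite big_nil addr0.
  rewrite IHs big_cons /write eqxx addrA; congr (_ + _).
split.
  apply: updates_correct_cat => //; apply: updates_correct_cat => //.
  by split=> //; elim: (enum _) (exec _ _ _ _) => //=.
rewrite !run_cat addE -/st2 /= /write eqxx add0r big_enum.
by apply: eq_bigr => v _; exact: run2.
Qed.

Lemma two_layer_program_correct :
  implements_forward Q r active (two_layer_program n active).
Proof.
by split=> [i u b|st];
  [exact: count_updates_two_layer | exact: two_layer_program_spec].
Qed.

End Semantics.

Lemma forward_unreachable (R : realType) n nu (Q : 'M[R]_n) r (k : nat)
    (u : nu.-tuple bool) :
  u \notin reachable k -> forward Q r k u = 0.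
Proof.
elim: k u => [|k IHk] v /=; first by rewrite inE => /negbTE ->.
case: insubP => // i _ _ v_unreach; apply: big1 => u _; apply: big1 => b.
move=> /eqP tr_u; rewrite IHk ?mul0r //; apply: contra v_unreach => u_reach.
by apply/imsetP; exists (u, b); rewrite // inE u_reach inE.
Qed.

(** * Operations and memory *)

Section Complexity.
Context {n nu : nat}.
Variable active : nat -> {set nu.-tuple bool}.

Local Open Scope nat_scope.

Lemma size_enum_state : size (enum {: nu.-tuple bool}) = 2 ^ nu.
Proof. by rewrite -cardE card_tuple card_bool. Qed.

(** A node costs at most 2 instructions besides its two subtrees, so the size plus 2 at most doubles
    with m. A leaf has at most 9 instructions, whence 11. *)
Lemma size_traverse (i : 'I_n) m w c :
  size (traverse active i m w c) + 2 <= 11 * 2 ^ m.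
Proof.
elim: m w c => [|m IHm] w c.
  by rewrite /= /state_code; case: ifP.
rewrite traverseS size_cat expnS.
have := IHm (rcons w false) c; have := IHm (rcons w true) c.
have := IHm (rcons w true) (reg nu m.+2).
by case: ifP => _; rewrite ?size_cat /=; lia.
Qed.

Lemma size_layer_code (i : 'I_n) :
  size (layer_code active i) <= 12 * 2 ^ nu.
Proof.
rewrite size_cat size_map size_enum_state /=.
by have := size_traverse i nu [::] (reg nu nu.+2); lia.
Qed.

Lemma operations_two_layer_program : 0 < n ->
  operations (two_layer_program n active) <= 15 * (n * 2 ^ nu).
Proof.
move=> n_gt0; rewrite /operations !size_cat [size (_ :: _)]/= 2!size_map.
rewrite size_enum_state.
suff : size (flatten [seq layer_code active i | i <- enum 'I_n])
    <= n * (12 * 2 ^ nu).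
  (* Beyond the 12 for the layers, initialisation, clearing the output and the final summation each
     cost at most n * 2 ^ nu, which gives 15. *)
  have : 2 ^ nu <= n * 2 ^ nu by rewrite leq_pmull.
  have : 0 < 2 ^ nu by rewrite expn_gt0.
  lia.
rewrite -[X in _ <= X * _](size_enum_ord n).
elim: (enum 'I_n) => //= i s IHs.
by rewrite size_cat mulSn leq_add // size_layer_code.
Qed.

(** The nu + 3 registers are the output, the scratch cell and the nu + 1 partial metrics for m = 0,
    ..., nu. *)
Definition two_layer_cell (x : cell nu) : bool :=
  match x with inl (k, _) => k < 2 | inr k => k < nu.+3 end.

Definition two_layer_cells_only (P : program n nu) : bool :=
  all (fun a => all two_layer_cell (cells_of a)) P.

Lemma working_memory_two_layer_cells (P : program n nu) :
  two_layer_cells_only P -> working_memory P <= 2 * 2 ^ nu + nu.+3.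
Proof.
move=> P_cells; pose cells : seq (cell nu) :=
  [seq buffer k v | k <- iota 0 2, v <- enum {: nu.-tuple bool}]
    ++ [seq reg nu k | k <- iota 0 nu.+3].
have <- : size cells = 2 * 2 ^ nu + nu.+3.
  by rewrite size_cat size_allpairs size_map !size_iota size_enum_state.
apply: uniq_leq_size (undup_uniq _) _ => x; rewrite mem_undup.
have /allP flat_cells : all two_layer_cell (flatten [seq cells_of a | a <- P]).
  by elim: P P_cells => //= a P IHP /andP[? /IHP]; rewrite all_cat => ->; apply/andP.
move=> /flat_cells x_cell.
rewrite mem_cat; apply/orP; case: x x_cell => [[k v]|k] k_bound.
  by left; apply: (allpairs_f (@buffer nu)); rewrite ?mem_iota ?mem_enum.
by right; apply: (map_f (reg nu)); rewrite mem_iota.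
Qed.

Lemma two_layer_cells_traverse (i : 'I_n) m w k : m <= nu -> k <= nu ->
  two_layer_cells_only (traverse active i m w (reg nu k.+2)).
Proof.
elim: m w k => [|m IHm] w k le_m le_k.
  rewrite /= /state_code; case: ifP => //= _.
  by rewrite !ltn_pmod //= !ltnS le_k.
rewrite traverseS /two_layer_cells_only all_cat.
apply/andP; split; first by apply: IHm; rewrite // ltnW.
case: ifP => _; last by apply: IHm; rewrite // ltnW.
by rewrite /= !ltnS le_k ltnW //=; apply: IHm; rewrite ltnW.
Qed.

Lemma two_layer_cells_two_layer_program :
  two_layer_cells_only (two_layer_program n active).
Proof.
rewrite /two_layer_cells_only all_cat; apply/andP; split.
  by rewrite all_map; apply/allP.
rewrite all_cat; apply/andP; split; last first.
  by rewrite /= all_map; apply/allP => v _ /=; rewrite ltn_pmod.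
elim: (enum 'I_n) => //= i s IHs; rewrite !all_cat IHs andbT; apply/andP; split.
  by rewrite all_map; apply/allP => v _ /=; rewrite ltn_pmod.
by rewrite /= !ltnS leqnn; apply: two_layer_cells_traverse.
Qed.

Lemma working_memory_two_layer_program :
  working_memory (two_layer_program n active) <= 6 * 2 ^ nu.
Proof.
apply: leq_trans (working_memory_two_layer_cells _ _) _.
  exact: two_layer_cells_two_layer_program.
(* The registers are absorbed by means of nu < 2 ^ nu. *)
by have := ltn_expl nu (ltnSn 1); lia.
Qed.

End Complexity.

Theorem propositionC1 (R : realType) :
  (forall (n nu : nat) (Q : 'M[R]_n) (r : 'cV[R]_n),
     (nu < n)%N -> symmetric_posdef Q -> half_bandwidth_le Q nu ->
     [/\ \sum_(v : nu.-tuple bool) forward Q r n v = partition_function Q r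
           /\ partition_function Q r
              = \sum_(u : n.-tuple bool) expR (- W Q r u),
         full_state_implementation Q r (full_state_program n nu)
           /\ reachable_state_implementation Q r (reachable_state_program n nu),
         forall P : program n nu, full_state_implementation Q r P ->
           branch_updates P = (2 * n * 2 ^ nu)%N,
         forall P : program n nu, reachable_state_implementation Q r P ->
           (branch_updates P <= 2 * n * 2 ^ nu)%N
       & forall (tie : rel (n.-tuple bool)),
           total tie -> antisymmetric tie -> transitive tie ->
         forall q : nat, (1 <= q <= 2 ^ n)%N ->
           full_space_weight Q r (pattern Q r tie q)
           = expR (- W Q r (pattern Q r tie q)) / partition_function Q r])
  /\ (exists C : nat, forall n nu : nat, (nu < n)%N ->
       [/\ (operations (full_state_program n nu) <= C * (n * 2 ^ nu))%N,
           (operations (reachable_state_program n nu) <= C * (n * 2 ^ nu))%N,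
           (working_memory (full_state_program n nu) <= C * 2 ^ nu)%N
         & (working_memory (reachable_state_program n nu) <= C * 2 ^ nu)%N])
  /\ (forall nu : nat, exists C : nat, forall n : nat, (nu < n)%N ->
       [/\ (operations (full_state_program n nu) <= C * n)%N,
           (operations (reachable_state_program n nu) <= C * n)%N,
           (working_memory (full_state_program n nu) <= C * n)%N
         & (working_memory (reachable_state_program n nu) <= C * n)%N]).
Proof.
have complexity n nu (active : nat -> {set nu.-tuple bool}) : (nu < n)%N ->
    (operations (two_layer_program n active) <= 15 * (n * 2 ^ nu))%N
    /\ (working_memory (two_layer_program n active) <= 15 * 2 ^ nu)%N.
  move=> lt_nu_n; split.
    by apply: operations_two_layer_program; exact: leq_trans lt_nu_n.
  by apply: leq_trans (working_memory_two_layer_program _) _; rewrite leq_mul2r orbT.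
split; [|split].
- move=> n nu Q r _ _ Qband; split=> //.
  + by split=> //; exact: sum_forward.
  + split; apply: two_layer_program_correct => i u.
      by rewrite inE.
    exact: forward_unreachable.
  + by move=> P; exact: full_branch_updates.
  + by move=> P; exact: reachable_branch_updates.
- exists 15%N => n nu lt_nu_n.
  have [? ?] := complexity n nu (fun=> [set: nu.-tuple bool]) lt_nu_n.
  by have [? ?] := complexity n nu (fun i => reachable i) lt_nu_n; split.
- move=> nu; exists (15 * 2 ^ nu)%N => n lt_nu_n.
  have n_gt0 : (0 < n)%N by exact: leq_trans lt_nu_n.
  (* The memory bound, free of n, is weakened to a linear one by n > 0. *)
  have linear m : (m <= 15 * 2 ^ nu -> m <= 15 * 2 ^ nu * n)%N.
    by move=> /leq_trans-> //; rewrite leq_pmulr.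
  have [] := complexity n nu (fun=> [set: nu.-tuple bool]) lt_nu_n.
  have [] := complexity n nu (fun i => reachable i) lt_nu_n.
  by rewrite [(n * _)%N]mulnC mulnA => ? /linear ? ? /linear ?; split.
Qed.
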